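(* Let $n\ge2$, let $\Omega$ be a family of $n$-ary multilinear polynomials, and let $T$ be a color $n$-ary $\Omega$-algebra over $F$. Let $\breve T=Tt+Tt^n$ be the color $n$-ary algebra with operation $[x_1t^{i_1},\ldots,x_nt^{i_n}]=[x_1,\ldots,x_n]t^{i_1+\cdots+i_n}$ ($i_j\in\{1,n\}$, $t^{k}=0$ for $k\ge n+1$). Let $U$ be a $G$-graded subspace of $T$ with $T=U\oplus[T,\ldots,T]$, so that $\breve T=Tt+Ut^n+[T,\ldots,T]t^n$, and define $\varphi:\mathrm{QDer}(T)\to\mathrm{End}(\breve T)$ by $$\varphi(D)(at+ut^n+bt^n)=D(a)t+D'(b)t^n,\qquad a\in T,\ u\in U,\ b\in[T,\ldots,T],$$ where $D\in\mathrm{QDer}(T)$ and $D'$ is a linear map associated with $D$ by the definition of quasiderivation. Then: (1) $\varphi$ is injective and $\varphi(D)$ does not depend on the choice of $D'$; (2) $\varphi(\mathrm{QDer}(T))\subseteq\mathrm{Der}(\breve T)$.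
   Context: $F$ is a field, $G$ is an abelian group (written additively), and $\epsilon:G\times G\to F^*$ is a bicharacter, i.e. $\epsilon(f,g+h)=\epsilon(f,g)\epsilon(f,h)$, $\epsilon(g+h,f)=\epsilon(g,f)\epsilon(h,f)$, $\epsilon(g,h)\epsilon(h,g)=1$ for all $f,g,h\in G$. A color $n$-ary algebra is a $G$-graded vector space $T=\bigoplus_{g\in G}T_g$ over $F$ with an $n$-linear map $[\cdot,\ldots,\cdot]$ such that $[T_{\theta_1},\ldots,T_{\theta_n}]\subseteq T_{\theta_1+\cdots+\theta_n}$. $[T,\ldots,T]$ denotes the span of all brackets. If $x\in T_g$ we write $hg(x)=g$; a linear map $D$ is homogeneous of degree $hg(D)=\theta$ if $D(T_g)\subseteq T_{g+\theta}$ for all $g$. For homogeneous elements or maps $a,b$ put $\epsilon(a,b)=\epsilon(hg(a),hg(b))$; for homogeneous $x_1,\ldots,x_n$ put $X_i=hg(x_1)+\cdots+hg(x_i)$, $X_0=0$, and $\epsilon(D,X_i)=\epsilon(hg(D),X_i)$. Elements and maps in formulas involving $\epsilon$ are homogeneous; $\mathrm{End}(T)$ is the $G$-graded space spanned by the homogeneous linear maps $T\to T$, and the sets below are the subspaces spanned by the homogeneous maps with the stated property, the construction $\varphi$ being extended linearly. A homogeneous $D$ belongs to $\mathrm{Der}(T)$ if $\sum_{i=1}^n\epsilon(D,X_{i-1})[x_1,\ldots,D(x_i),\ldots,x_n]=D([x_1,\ldots,x_n])$ for all homogeneous $x_1,\dots,x_n\in T$. It belongs to $\mathrm{QDer}(T)$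 (quasiderivation) if there is $D'\in\mathrm{End}(T)$ of the same degree such that $\sum_{i=1}^n\epsilon(D,X_{i-1})[x_1,\ldots,D(x_i),\ldots,x_n]=D'([x_1,\ldots,x_n])$ for all homogeneous $x_1,\ldots,x_n$. Color $n$-ary $\Omega$-algebras: let $f$ be an ($n$-ary) multilinear polynomial in $x_1,\ldots,x_m$ (a linear combination of nonassociative $n$-ary words each containing every variable exactly once). Fix the order $(x_{i_1},\ldots,x_{i_m})$ of the variables in one word of $f$ and write $f=\sum_{\beta,\sigma\in S_m}\alpha_{\sigma,\beta}[x_{\sigma(i_1)}\ldots x_{\sigma(i_m)}]_\beta$, $\beta$ being the arrangement of brackets. Let $\epsilon_\sigma$ be the product of $\epsilon(x_a,x_b)$ over all pairs such that $x_a$ precedes $x_b$ in the fixed order but follows it in the order $(x_{\sigma(i_1)},\ldots,x_{\sigma(i_m)})$, and put $f_{co}=\sum\alpha_{\sigma,\beta}\epsilon_\sigma[x_{\sigma(i_1)}\ldots x_{\sigma(i_m)}]_\beta$. For a family $\Omega=\{f_i\}$, a color $n$-ary $\Omega$-algebra is a color $n$-ary algebra satisfying all identities $(f_i)_{co}=0$ on homogeneous elements. $xt$, $xt^n$ abbreviate $x\otimes t$, $x\otimes t^n$; the grading on $\breve T$ is $\breve T_g=T_gt+T_gt^n$. *)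

(* Defs.v *)
From HB Require Import structures.
From mathcomp Require Import all_boot all_order all_algebra.
From mathcomp Require Import boolp classical_sets functions.

Set Implicit Arguments.
Unset Strict Implicit.
Unset Printing Implicit Defensive.

Import GRing.Theory.
Local Open Scope classical_set_scope.
Local Open Scope ring_scope.

Section Subspaces.
Variables (F : fieldType) (G : zmodType) (V : lmodType F).

Record subspace (A : set V) : Prop := Subspace {
  subspace0 : A 0;
  subspaceP : forall (a : F) (u v : V), A u -> A v -> A (a *: u + v) }.

Definition span (A : set V) : set V :=
  [set v | exists2 s : seq (F * V),
     (forall p, p \in s -> A p.2) & v = \sum_(p <- s) p.1 *: p.2].

Record is_grading (hcomp : G -> set V) : Prop := IsGrading {
  grading_subspace : forall g, subspace (hcomp g);
  grading_sum : forall v : V, exists (s : seq G) (c : G -> V),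
    (forall g, hcomp g (c g)) /\ v = \sum_(g <- s) c g;
  grading_direct : forall (s : seq G) (c : G -> V), uniq s ->
    (forall g, hcomp g (c g)) -> \sum_(g <- s) c g = 0 ->
    forall g, g \in s -> c g = 0 }.

Record graded_subspace (hcomp : G -> set V) (A : set V) : Prop :=
  GradedSubspace {
    graded_subspaceS : subspace A;
    graded_subspaceP : forall v, A v -> exists (s : seq G) (c : G -> V),
      (forall g, hcomp g (c g) /\ A (c g)) /\ v = \sum_(g <- s) c g }.

(* V is the internal direct sum of the subspaces A and B. *)
Definition direct_sum (A B : set V) : Prop :=
  (forall v, exists2 a, A a & exists2 b, B b & v = a + b) /\
  A `&` B `<=` [set 0].

End Subspaces.

Record bicharacter (F : fieldType) (G : zmodType) (eps : G -> G -> F) : Prop :=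
  Bicharacter {
    bichar_neq0 : forall g h, eps g h != 0;
    bicharDr : forall f g h, eps f (g + h) = eps f g * eps f h;
    bicharDl : forall f g h, eps (g + h) f = eps g f * eps h f;
    bichar_skew : forall g h, eps g h * eps h g = 1 }.

Definition subst_at (n : nat) (T : Type) (x : {ffun 'I_n -> T}) (i : 'I_n)
    (y : T) : {ffun 'I_n -> T} :=
  [ffun j => if j == i then y else x j].

Definition multilinear (F : fieldType) (n : nat) (V W : lmodType F)
    (b : {ffun 'I_n -> V} -> W) : Prop :=
  forall (x : {ffun 'I_n -> V}) (i : 'I_n) (a : F) (u v : V),
    b (subst_at x i (a *: u + v)) =
    a *: b (subst_at x i u) + b (subst_at x i v).

Record color_algebra (F : fieldType) (G : zmodType) (n : nat) :=
  ColorAlgebra {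
    carrier :> lmodType F;
    hcomp : G -> set carrier;
    br : {ffun 'I_n -> carrier} -> carrier;
    comp_grading : is_grading hcomp;
    br_multilinear : multilinear br;
    br_graded : forall (d : 'I_n -> G) (x : {ffun 'I_n -> carrier}),
      (forall i, hcomp (d i) (x i)) -> hcomp (\sum_i d i) (br x) }.

Arguments hcomp {F G n} c g.
Arguments br {F G n c} x.

(* [T, ..., T] *)
Definition derived (F : fieldType) (G : zmodType) (n : nat)
    (T : color_algebra F G n) : set T :=
  span (range (@br F G n T)).

Arguments derived {F G n} T x.

Section Polynomials.
Variables (F : fieldType) (n : nat).

Inductive word (m : nat) : Type :=
  | WVar of 'I_m
  | WBr of {ffun 'I_n -> word m}.

Fixpoint leaves (m : nat) (w : word m) : seq 'I_m :=
  match w with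
  | WVar a => [:: a]
  | WBr f => flatten [seq leaves (f i) | i <- enum 'I_n]
  end.

(* The linear combination is presented by a list of (coefficient, word)
   pairs; every word contains each of the variables exactly once. *)
Record multilinear_poly : Type := MultilinearPoly {
  arity : nat;
  terms : seq (F * word arity);
  terms_multilinear : all (fun p => perm_eq (leaves p.2) (enum 'I_arity)) terms
}.

(* The fixed order of the variables is the one in the first word.  Another
   choice multiplies f_co by a product of values of the bicharacter, which is
   nonzero, so it does not affect the identity f_co = 0. *)
Definition ref_order (f : multilinear_poly) : seq 'I_(arity f) :=
  if terms f is p :: _ then leaves p.2 else [::].

End Polynomials.

Section Identities.
Variables (F : fieldType) (G : zmodType) (eps : G -> G -> F) (n : nat).
Variable T : color_algebra F G n.

Fixpoint eval_word (m : nat) (x : 'I_m -> T) (w : word n m) : T :=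
  match w with
  | WVar a => x a
  | WBr f => br [ffun i => eval_word x (f i)]
  end.

Definition eps_order (m : nat) (d : 'I_m -> G) (s t : seq 'I_m) : F :=
  \prod_(a < m) \prod_(b < m | (index a s < index b s)%N
                                 && (index b t < index a t)%N)
     eps (d a) (d b).

Definition eval_co (f : multilinear_poly F n) (d : 'I_(arity f) -> G)
    (x : 'I_(arity f) -> T) : T :=
  \sum_(p <- terms f)
     (p.1 * eps_order d (ref_order f) (leaves p.2)) *: eval_word x p.2.

Definition omega_algebra (I : Type) (Omega : I -> multilinear_poly F n) : Prop :=
  forall (k : I) (d : 'I_(arity (Omega k)) -> G) (x : 'I_(arity (Omega k)) -> T),
    (forall a, hcomp T (d a) (x a)) -> eval_co d x = 0.

End Identities.

Section Derivations.
Variables (F : fieldType) (G : zmodType) (eps : G -> G -> F) (n : nat).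
Variable T : color_algebra F G n.

Definition homogeneous_map (theta : G) (D : T -> T) : Prop :=
  linear D /\ forall g x, hcomp T g x -> hcomp T (g + theta) (D x).

(* sum_i eps(D, X_{i-1}) [x_1, ..., D x_i, ..., x_n] = D' [x_1, ..., x_n]
   on homogeneous x_i, for D of degree theta *)
Definition qder_identity (theta : G) (D D' : T -> T) : Prop :=
  forall (d : 'I_n -> G) (x : {ffun 'I_n -> T}),
    (forall i, hcomp T (d i) (x i)) ->
    \sum_(i < n) eps theta (\sum_(j < n | (j < i)%N) d j)
                   *: br (subst_at x i (D (x i))) = D' (br x).

Definition homogeneous_der (D : T -> T) : Prop :=
  exists2 theta, homogeneous_map theta D & qder_identity theta D D.

Definition Der : set (T -> T) := span [set D | homogeneous_der D].

Definition homogeneous_qder_with (D D' : T -> T) : Prop :=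
  exists theta, [/\ homogeneous_map theta D, homogeneous_map theta D'
                  & qder_identity theta D D'].

Definition QDer : set (T -> T) :=
  span [set D | exists D', homogeneous_qder_with D D'].

(* D' is associated with D when D = sum_k a_k D_k and D' = sum_k a_k D'_k for
   homogeneous quasiderivations D_k with respective maps D'_k: this is the
   relation of the definition of quasiderivations, extended linearly. *)
Definition associated (D D' : T -> T) : Prop :=
  span [set p : (T -> T) * (T -> T) | homogeneous_qder_with p.1 p.2] (D, D').

Lemma QDerP (D : T -> T) : QDer D <-> exists D', associated D D'.
Proof.
split=> [[s sP ->]|[D' [s sP e]]].
- suff [t tP <-] : exists2 t : seq (F * ((T -> T) * (T -> T))),
      (forall p, p \in t -> homogeneous_qder_with p.2.1 p.2.2) &
      (\sum_(p <- t) p.1 *: p.2).1 = \sum_(p <- s) p.1 *: p.2.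
    by exists (\sum_(p <- t) p.1 *: p.2).2, t => //; rewrite -surjective_pairing.
  elim: s sP => [|[a E] s IH] sP.
    by exists [::] => //; rewrite !big_nil.
  have [p ps|t tP te] := IH; first by apply: sP; rewrite in_cons ps orbT.
  have [E' EP] := sP (a, E) (mem_head _ _).
  exists ((a, (E, E')) :: t); last by rewrite !big_cons -te.
  by move=> p; rewrite in_cons => /predU1P[->|/tP].
- exists [seq (p.1, p.2.1) | p <- s].
    by move=> _ /mapP[p /sP ? ->] /=; exists p.2.2.
  rewrite big_map; have -> : D = (D, D').1 by []; rewrite e.
  exact: (big_morph (fun p : (T -> T) * (T -> T) => p.1)).
Qed.

End Derivations.

Arguments Der {F G} eps {n} T _.
Arguments QDer {F G} eps {n} T _.

(* T t + T t^n, where (a, c) stands for a t + c t^n. *)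
Section Breve.
Variables (F : fieldType) (G : zmodType) (n : nat) (T : color_algebra F G n).

Definition breve_comp (g : G) : set (T * T)%type :=
  [set x | hcomp T g x.1 /\ hcomp T g x.2].

(* y t^k; only the exponents k = 1, k = n and k > n occur. *)
Definition breve_mono (k : nat) (y : T) : (T * T)%type :=
  if k == 1%N then (y, 0) else if k == n then (0, y) else 0.

Definition breve_expo (s : bool) : nat := if s then n else 1%N.

Definition breve_coef (s : bool) (x : (T * T)%type) : T :=
  if s then x.2 else x.1.

(* The multilinear extension of
   [x_1 t^{i_1}, ..., x_n t^{i_n}] = [x_1, ..., x_n] t^{i_1 + ... + i_n}:
   s j tells whether the t^n-part or the t-part of the jth argument is taken. *)
Definition breve_br (x : {ffun 'I_n -> (T * T)%type}) : (T * T)%type :=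
  \sum_(s : {ffun 'I_n -> bool})
     breve_mono (\sum_(j < n) breve_expo (s j))
                (br [ffun j => breve_coef (s j) (x j)]).

Lemma breve_mono_linear k : linear (breve_mono k).
Proof.
move=> a u v; rewrite /breve_mono; case: ifP => _; last case: ifP => _.
- by congr pair; rewrite /= scaler0 addr0.
- by congr pair; rewrite /= scaler0 addr0.
- by rewrite scaler0 addr0.
Qed.

Lemma breve_coef_linear s : linear (breve_coef s).
Proof. by case: s. Qed.

Lemma breve_br_multilinear : multilinear breve_br.
Proof.
move=> x i a u v; rewrite /breve_br scaler_sumr -big_split /=.
apply: eq_bigr => s _; rewrite -breve_mono_linear; congr breve_mono.
have E w : [ffun j => breve_coef (s j) (subst_at x i w j)] =
    subst_at [ffun j => breve_coef (s j) (x j)] i (breve_coef (s i) w).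
  by apply/ffunP => j; rewrite !ffunE; case: eqP => // ->.
by rewrite !E breve_coef_linear br_multilinear.
Qed.

Lemma breve_comp_subspace g : subspace (breve_comp g).
Proof.
have [c0 cP] := grading_subspace (comp_grading T) g.
by split=> [|a u v [? ?] [? ?]]; split=> //=; apply: cP.
Qed.

Lemma breve_sum1 (J : Type) (s : seq J) (c : J -> (T * T)%type) :
  (\sum_(g <- s) c g).1 = \sum_(g <- s) (c g).1.
Proof. exact: (big_morph (fun p : (T * T)%type => p.1)). Qed.

Lemma breve_sum2 (J : Type) (s : seq J) (c : J -> (T * T)%type) :
  (\sum_(g <- s) c g).2 = \sum_(g <- s) (c g).2.
Proof. exact: (big_morph (fun p : (T * T)%type => p.2)). Qed.

(* Any decomposition into homogeneous components may be taken over a larger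
   duplicate-free list of degrees. *)
Lemma grading_sum_widen (v : T) : exists (s : seq G),
  forall s', uniq s' -> {subset s <= s'} ->
  exists c : G -> T, (forall g, hcomp T g (c g)) /\ v = \sum_(g <- s') c g.
Proof.
have gs g := grading_subspace (comp_grading T) g.
have [s [c [cP ->]]] := grading_sum (comp_grading T) v.
exists s => s' us' ss'.
exists (fun g => \sum_(h <- s | h == g) c h); split=> [g|].
- elim/big_rec: _ => [|h y /eqP -> cy]; first exact: subspace0.
  by rewrite -[c g]scale1r; apply: (subspaceP (gs g)).
- rewrite (exchange_big_dep predT) //= big_seq_cond [RHS]big_seq_cond.
  apply: eq_bigr => h /andP[/ss' hs' _].
  under eq_bigl => g do rewrite eq_sym.
  by rewrite -big_filter filter_pred1_uniq // big_seq1.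
Qed.

Lemma breve_grading : is_grading breve_comp.
Proof.
split; first exact: breve_comp_subspace.
- move=> [a c].
  have [s1 h1] := grading_sum_widen a.
  have [s2 h2] := grading_sum_widen c.
  have ut := undup_uniq (s1 ++ s2).
  have [|c1 [c1P e1]] := h1 _ ut.
    by move=> g gs; rewrite mem_undup mem_cat gs.
  have [|c2 [c2P e2]] := h2 _ ut.
    by move=> g gs; rewrite mem_undup mem_cat gs orbT.
  exists (undup (s1 ++ s2)), (fun g => (c1 g, c2 g)); split=> //.
  apply/eqP; rewrite -pair_eqE /pair_eq /= breve_sum1 breve_sum2 /=.
  by rewrite -e1 -e2 !eqxx.
- move=> s c us cP e g gs.
  have D := grading_direct (comp_grading T) us.
  have z1 : (c g).1 = 0.
    apply: (D (fun g => (c g).1)) => // [h|]; first by have [] := cP h.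
    by rewrite -breve_sum1 e.
  have z2 : (c g).2 = 0.
    apply: (D (fun g => (c g).2)) => // [h|]; first by have [] := cP h.
    by rewrite -breve_sum2 e.
  by rewrite [c g]surjective_pairing z1 z2.
Qed.

Lemma breve_br_graded (d : 'I_n -> G) (x : {ffun 'I_n -> (T * T)%type}) :
  (forall i, breve_comp (d i) (x i)) -> breve_comp (\sum_i d i) (breve_br x).
Proof.
move=> xP; have [z zP] := breve_comp_subspace (\sum_i d i).
rewrite /breve_br; apply: (big_ind (breve_comp (\sum_i d i))) => // [y y' ? ?|s _].
  by rewrite -[y]scale1r; apply: zP.
have b : hcomp T (\sum_i d i) (br [ffun j => breve_coef (s j) (x j)]).
  apply: br_graded => i; rewrite ffunE; have [] := xP i.
  by case: (s i).
have c0 := subspace0 (grading_subspace (comp_grading T) (\sum_i d i)).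
by rewrite /breve_mono; case: ifP => _; last case: ifP => _; split.
Qed.

Definition breve : color_algebra F G n :=
  ColorAlgebra breve_grading breve_br_multilinear breve_br_graded.

End Breve.

Section Phi.
Variables (F : fieldType) (G : zmodType) (eps : G -> G -> F) (n : nat).
Variables (T : color_algebra F G n) (U : set T).

(* The projection onto [T, ..., T] along U. *)
Definition derived_part (x : T) : T :=
  xget 0 [set b | derived T b /\ U (x - b)].

Definition phi_with (D D' : T -> T) : breve T -> breve T :=
  fun x : (T * T)%type => (D x.1, D' (derived_part x.2)).

(* Some map associated with D is chosen; the choice is meaningful for D in
   QDer eps T, by QDerP. *)
Definition phi (D : T -> T) : breve T -> breve T :=
  phi_with D (xget 0 [set D' | associated eps D D']).

Lemma span_subspace (A : set T) : subspace (span A).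
Proof.
split; first by exists [::] => //; rewrite big_nil.
move=> a _ _ [s sP ->] [t tP ->].
exists ([seq (a * p.1, p.2) | p <- s] ++ t).
  by move=> p; rewrite mem_cat => /orP[/mapP[q /sP ? ->]|/tP].
rewrite big_cat big_map scaler_sumr; congr (_ + _).
by apply: eq_bigr => p _; rewrite scalerA.
Qed.

Lemma phi_with_linear (a : F) (D D' E E' : T -> T) :
  phi_with (a *: D + E) (a *: D' + E') = a *: phi_with D D' + phi_with E E'.
Proof. by []. Qed.

(* phi(D)(a t + u t^n + b t^n) = D(a) t + D'(b) t^n *)
Lemma phi_withE (D D' : T -> T) (a u b : T) :
  subspace U -> direct_sum U (derived T) -> U u -> derived T b ->
  phi_with D D' (a, u + b) = (D a, D' b).
Proof.
move=> sU [_ UT0] Uu Tb; congr pair => /=; congr D'.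
have sT := span_subspace (range (@br F G n T)).
have [Tc Uc] : [set c | derived T c /\ U (u + b - c)] (derived_part (u + b)).
  by apply: (xgetI 0 (x := b)); split=> //; rewrite addrK.
move: (derived_part _) Tc Uc => c Tc Uc.
suff : (U `&` derived T) (b - c) by move=> /UT0 /subr0_eq.
split.
- rewrite (_ : b - c = (-1) *: u + (u + b - c)); first exact: (subspaceP sU).
  by rewrite scaleN1r -!addrA addKr.
- by rewrite addrC -scaleN1r; apply: (subspaceP sT).
Qed.

End Phi.

(* Main.v *)
Require Import Defs.
From mathcomp Require Import all_boot all_order all_algebra.
From mathcomp Require Import boolp classical_sets functions.
Local Open Scope classical_set_scope.
Local Open Scope ring_scope.

Import GRing.Theory.

Set Implicit Arguments.
Unset Strict Implicit.
Unset Printing Implicit Defensive.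

(** Since [n >= 2], a product of [n] monomials of [breve T] survives only when
all of them have exponent 1: any factor [t^n] already pushes the total exponent
beyond [n].  Hence the bracket of [breve T] depends only on the [t]-parts and
lands in [[T, ..., T] t^n] ([breve_brE]).  There [phi D] acts as [D'], while it
acts as [D] on the arguments, so that the derivation identity for [phi D] is
the quasiderivation identity for the pair [(D, D')] ([phi_with_der]).  That
[phi D] is again linear and homogeneous is a property of the projection onto
[[T, ..., T]] along [U], both summands being graded.

Injectivity is visible on [T t].  For the independence of [D'], linearity
reduces to the claim that a map [E] associated with [0] vanishes on
[[T, ..., T]] ([associated0]).  The subtle point is that [0] may be presented as
a combination of homogeneous quasiderivations [D_k] of several degrees
[theta_k], each entering its identity with its own factor
[eps (theta_k, X_(i-1))].  On a homogeneous argument, the values of maps of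
different degrees lie in different components, so that a vanishing sum still
vanishes after each term is multiplied by a scalar depending only on its degree
([grading_reweight]). *)

(* the span of an arbitrary set, not that of a finite sequence of vectors *)
Local Notation span := Defs.span.

(** * Linear maps and subspaces *)

Section Linear.
Variables (F : fieldType) (V W : lmodType F).

Lemma linear_comb (J : Type) (f : V -> W) (s : seq J) (P : pred J)
    (a : J -> F) (v : J -> V) :
  linear f ->
  f (\sum_(j <- s | P j) a j *: v j) = \sum_(j <- s | P j) a j *: f (v j).
Proof.
move=> fl.
have f0 : f 0 = 0 by have := fl (-1) 0 0; rewrite !scaleN1r oppr0 addr0 addNr.
by apply: (big_ind2 (fun x y => f x = y)) => [//|x _ y _ <- <-|j _];
  [rewrite -[x]scale1r fl !scale1r | rewrite -[_ *: v j]addr0 fl f0 addr0].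
Qed.

Lemma linear_sum_seq (J : Type) (f : V -> W) (s : seq J) (v : J -> V) :
  linear f -> f (\sum_(j <- s) v j) = \sum_(j <- s) f (v j).
Proof.
move=> fl; have := linear_comb s predT (fun=> 1) v fl.
by under eq_bigr do rewrite scale1r; under [RHS]eq_bigr do rewrite scale1r.
Qed.

Lemma linear_zero (f : V -> W) : linear f -> f 0 = 0.
Proof. by move=> fl; have := linear_sum_seq [::] id fl; rewrite !big_nil. Qed.

Lemma subspace_sum (A : set V) (J : eqType) (s : seq J) (P : pred J)
    (v : J -> V) :
  subspace A -> (forall j, j \in s -> P j -> A (v j)) ->
  A (\sum_(j <- s | P j) v j).
Proof.
move=> [A0 AP] vP; rewrite big_seq_cond.
apply: (big_ind A) => // [x y Ax Ay|j /andP[js Pj]]; last exact: vP.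
by rewrite -[x]scale1r; apply: AP.
Qed.

Lemma span_le (A B : set V) : subspace B -> A `<=` B -> span A `<=` B.
Proof.
move=> sB AB _ [s sP ->]; apply: subspace_sum => // p /sP /AB Bp _.
by rewrite -[_ *: _]addr0; apply: (subspaceP sB) => //; apply: subspace0.
Qed.

Lemma sub_span (A : set V) : A `<=` span A.
Proof.
move=> v Av; exists [:: (1, v)]; last by rewrite big_seq1 scale1r.
by move=> p; rewrite inE => /eqP ->.
Qed.

Lemma subspace_span (A : set V) : subspace (span A).
Proof.
split; first by exists [::] => //; rewrite big_nil.
move=> a _ _ [s sP ->] [t tP ->].
exists ([seq (a * p.1, p.2) | p <- s] ++ t).
  by move=> p; rewrite mem_cat => /orP[/mapP[q /sP ? ->]|/tP].
rewrite big_cat big_map scaler_sumr; congr (_ + _).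
by apply: eq_bigr => p _; rewrite scalerA.
Qed.

Lemma ker_subspace (f : V -> W) : linear f -> subspace [set v | f v = 0].
Proof.
move=> fl; split=> [|a u v /= fu fv]; first exact: linear_zero.
by rewrite fl fu fv scaler0 addr0.
Qed.

End Linear.

(** * Gradings and brackets of homogeneous elements *)

Section Graded.
Variables (F : fieldType) (G : zmodType).

(** Grouping the terms by degree, each homogeneous component of the sum
vanishes separately, and the weight is constant on it.  With a weight given by
the bicharacter this compares the twisted identities of maps of different
degrees; with the indicator of one degree it extracts a homogeneous
component. *)
Lemma grading_reweight (V : lmodType F) (comp : G -> set V) (J : eqType)
    (s : seq J) (th : J -> G) (v : J -> V) (c : G -> F) :
  is_grading comp ->
  (forall j, j \in s -> comp (th j) (v j)) ->
  \sum_(j <- s) v j = 0 -> \sum_(j <- s) c (th j) *: v j = 0.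
Proof.
move=> gr vP v0.
have regroup (w : J -> V) : \sum_(j <- s) w j =
    \sum_(h <- undup (map th s)) \sum_(j <- s | th j == h) w j.
  rewrite (exchange_big_dep predT) //= big_seq_cond [RHS]big_seq_cond.
  apply: eq_bigr => j /andP[js _].
  under eq_bigl => h do rewrite eq_sym.
  rewrite -big_filter filter_pred1_uniq ?undup_uniq ?big_seq1 //.
  by rewrite mem_undup map_f.
rewrite regroup big_seq_cond big1 // => h /andP[hs _].
rewrite (eq_bigr (fun j => c h *: v j)) => [|j /eqP -> //].
rewrite -scaler_sumr.
rewrite (grading_direct gr (undup_uniq (map th s))
  (c := fun h => \sum_(j <- s | th j == h) v j)) ?scaler0 // => [k|].
- apply: subspace_sum; first exact: (grading_subspace gr).
  by move=> j js /eqP <-; apply: vP.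
- by rewrite -regroup.
Qed.

Variables (n : nat) (T : color_algebra F G n).

Lemma subst_at_id (x : {ffun 'I_n -> T}) i : subst_at x i (x i) = x.
Proof. by apply/ffunP => j; rewrite ffunE; case: eqP => // ->. Qed.

Lemma br_subst_linear (x : {ffun 'I_n -> T}) i :
  linear (fun y => br (subst_at x i y)).
Proof. by move=> a u v; apply: br_multilinear. Qed.

Definition homogeneous_brackets : set T :=
  [set v | exists (d : 'I_n -> G) (x : {ffun 'I_n -> T}),
     (forall i, hcomp T (d i) (x i)) /\ v = br x].

(** The arguments of a bracket are decomposed into homogeneous components one
after the other: the induction is on the number [k] of initial arguments that
need not be homogeneous yet. *)
Lemma br_span_homogeneous (x : {ffun 'I_n -> T}) :
  span homogeneous_brackets (br x).
Proof.
have main k : (k <= n)%N -> forall x : {ffun 'I_n -> T},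
    (forall i : 'I_n, (k <= i)%N -> exists g, hcomp T g (x i)) ->
    span homogeneous_brackets (br x).
  elim: k => [_ {}x xP|k IH kn {}x xP].
    have [d dP] := choice (fun i => xP i (leq0n i)).
    by apply: sub_span; exists d, x.
  pose i := Ordinal kn.
  have [s [c [cP xi]]] := grading_sum (comp_grading T) (x i).
  rewrite -(subst_at_id x i) xi (linear_sum_seq _ _ (br_subst_linear x i)).
  apply: subspace_sum => [|g _ _]; first exact: subspace_span.
  apply: IH => [|j kj]; first exact: ltnW.
  rewrite ffunE; case: eqVneq => [_|ji]; first by exists g.
  by apply: xP; rewrite ltn_neqAle kj andbT eq_sym.
by apply: (main n) => // i; rewrite leqNgt ltn_ord.
Qed.

Lemma derived_span_homogeneous :
  derived T `<=` span homogeneous_brackets.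
Proof.
apply: span_le; first exact: subspace_span.
by move=> _ [x _ <-]; apply: br_span_homogeneous.
Qed.

Lemma br_derived (x : {ffun 'I_n -> T}) : derived T (br x).
Proof. by apply: sub_span; exists x. Qed.

Lemma derived_decomposition (b : T) : derived T b ->
  exists s : seq (G * T),
    (forall p, p \in s -> hcomp T p.1 p.2 /\ derived T p.2) /\
    b = \sum_(p <- s) p.2.
Proof.
move=> /derived_span_homogeneous [s sP ->].
elim: s sP => [|[a v] s IH] sP; first by exists [::]; rewrite !big_nil.
have [p ps|t [tP te]] := IH; first by apply: sP; rewrite in_cons ps orbT.
have [d [x [xd /= vE]]] := sP (a, v) (mem_head _ _).
exists ((\sum_i d i, a *: v) :: t); split; last by rewrite !big_cons te.
move=> p; rewrite in_cons => /predU1P[->|/tP //] /=.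
have sg := grading_subspace (comp_grading T) (\sum_i d i).
have sd := subspace_span (range (@br F G n T)).
rewrite -[a *: v]addr0 vE; split.
- by apply: (subspaceP sg); [apply: br_graded | apply: subspace0 sg].
- by apply: (subspaceP sd); [apply: br_derived | apply: subspace0 sd].
Qed.

End Graded.

(** * The projection onto [[T, ..., T]] *)

Section Projection.
Variables (F : fieldType) (G : zmodType) (n : nat) (T : color_algebra F G n).
Variable U : set T.
Hypotheses (hU : graded_subspace (hcomp T) U) (hUT : direct_sum U (derived T)).

Let sU : subspace U := graded_subspaceS hU.
Let sD : subspace (derived T) := subspace_span (range (@br F G n T)).

Lemma derived_part_add (u b : T) :
  U u -> derived T b -> derived_part U (u + b) = b.
Proof.
by move=> Uu Tb; have [] := phi_withE id id 0 sU hUT Uu Tb.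
Qed.

Lemma derived_part_id (b : T) : derived T b -> derived_part U b = b.
Proof. by move=> Tb; rewrite -[b in LHS]add0r derived_part_add //; case: sU. Qed.

Lemma derived_part_in (x : T) : derived T (derived_part U x).
Proof. by have [u Uu [b Tb ->]] := hUT.1 x; rewrite derived_part_add. Qed.

Lemma derived_part_linear : linear (derived_part U).
Proof.
move=> a x y; have [u Uu [b Tb ->]] := hUT.1 x; have [v Uv [c Tc ->]] := hUT.1 y.
rewrite scalerDr addrACA !derived_part_add //.
- exact: (subspaceP sU).
- exact: (subspaceP sD).
Qed.

(** Extracting the degree-[g] terms of [x = u + b], with [u] and [b] decomposed
inside the graded subspaces [U] and [[T, ..., T]], writes [x] again as a sum of
elements of the two subspaces, the second of which has degree [g]. *)
Lemma derived_part_homogeneous (g : G) (x : T) :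
  hcomp T g x -> hcomp T g (derived_part U x).
Proof.
move=> xg; have [u Uu [b Tb xE]] := hUT.1 x.
have [s [c [cP uE]]] := graded_subspaceP hU Uu.
have [t [tP bE]] := derived_decomposition Tb.
pose l := (g, - x) :: [seq (h, c h) | h <- s] ++ t.
have lP p : p \in l -> hcomp T p.1 p.2.
  rewrite in_cons mem_cat => /predU1P[->|/orP[/mapP[h _ ->]|/tP[]//]] /=.
    have sg := grading_subspace (comp_grading T) g.
    by rewrite -scaleN1r -[_ *: _]addr0; apply: (subspaceP sg) => //; case: sg.
  by have [] := cP h.
have l0 : \sum_(p <- l) p.2 = 0.
  by rewrite big_cons big_cat big_map /= -uE -bE xE addNr.
have := grading_reweight (fun h => (h == g)%:R) (comp_grading T) lP l0.
have indicator (J : Type) (r : seq J) (d : J -> G) (w : J -> T) :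
    \sum_(j <- r) (d j == g)%:R *: w j = \sum_(j <- r | d j == g) w j.
  rewrite [RHS]big_mkcond; apply: eq_bigr => j _.
  by case: eqP; rewrite ?scale1r ?scale0r.
rewrite big_cons big_cat big_map /= eqxx scale1r !indicator.
move/eqP; rewrite [- x + _]addrC subr_eq0 => /eqP <-.
rewrite derived_part_add.
- apply: subspace_sum; first exact: grading_subspace (comp_grading T) g.
  by move=> p /tP[pd _] /eqP <-.
- by apply: subspace_sum => // h _ _; have [] := cP h.
- by apply: subspace_sum => // p /tP[].
Qed.

End Projection.

(** * Independence of the associated map *)

Section Associated.
Variables (F : fieldType) (G : zmodType) (eps : G -> G -> F) (n : nat).
Variable T : color_algebra F G n.

Lemma associated_linear (D D' : T -> T) : associated eps D D' -> linear D'.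
Proof.
move=> h.
apply: (span_le (B := [set p : (T -> T) * (T -> T) | linear p.2]) _ _ h);
  last by move=> p [theta [_ []]].
split=> [a u v /=|a [p p'] [q q'] /= lp lq b u v].
- by rewrite /= scaler0 addr0.
- change (a *: p' (b *: u + v) + q' (b *: u + v) =
    b *: (a *: p' u + q' u) + (a *: p' v + q' v)).
  by rewrite lp lq !scalerDr !scalerA mulrC addrACA.
Qed.

(** For homogeneous [x], the value of [E] at [br x] is the sum over [i] of the
brackets with [i]-th argument [\sum_k a_k eps (theta_k, X_(i-1)) D_k (x_i)];
these arguments vanish because [\sum_k a_k D_k (x_i)] does. *)
Lemma associated0 (E : T -> T) (b : T) :
  associated eps (0 : T -> T) E -> derived T b -> E b = 0.
Proof.
move=> hE; have El := associated_linear hE.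
move=> /derived_span_homogeneous; move: b.
apply: span_le; first exact: ker_subspace.
move=> _ /= [d [x [xd ->]]].
case: hE => s sP sE.
have s1 y : \sum_(p <- s) p.1 *: p.2.1 y = 0.
  transitivity ((\sum_(p <- s) p.1 *: p.2).1 y); last by rewrite -sE.
  by elim/big_rec2: _ => // p f g _ ->.
have s2 y : E y = \sum_(p <- s) p.1 *: p.2.2 y.
  rewrite -[E]/((0 : T -> T, E).2) sE.
  by elim/big_rec2: _ => // p f g _ <-.
(* the zero map has every degree, so a pair may satisfy the definition for
   several degrees, and one has to be selected *)
pose degrees (p : F * ((T -> T) * (T -> T))) : set G :=
  [set theta | [/\ homogeneous_map theta p.2.1,
    homogeneous_map theta p.2.2 & qder_identity eps theta p.2.1 p.2.2]].
pose th p := xget 0 (degrees p).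
have thP p : p \in s -> [/\ homogeneous_map (th p) p.2.1,
    homogeneous_map (th p) p.2.2 & qder_identity eps (th p) p.2.1 p.2.2].
  by move=> /sP [theta tP]; apply: (@xgetI _ 0 (degrees p) theta).
pose X (i : 'I_n) := \sum_(j < n | (j < i)%N) d j.
transitivity (\sum_(p <- s) \sum_(i < n)
    (p.1 * eps (th p) (X i)) *: br (subst_at x i (p.2.1 (x i)))).
  rewrite s2 big_seq [RHS]big_seq; apply: eq_bigr => p ps.
  have [_ _ /(_ d x xd) <-] := thP p ps.
  by rewrite scaler_sumr; apply: eq_bigr => i _; rewrite scalerA.
rewrite exchange_big big1 // => i _ /=.
rewrite -(linear_comb s predT (fun p => p.1 * eps (th p) (X i))
  (fun p => p.2.1 (x i)) (br_subst_linear x i)).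
have -> : \sum_(p <- s) (p.1 * eps (th p) (X i)) *: p.2.1 (x i) = 0.
  have vP p : p \in s -> hcomp T (d i + th p) (p.1 *: p.2.1 (x i)).
    move=> /thP[[_ /(_ _ _ (xd i)) Dg] _ _].
    have sg := grading_subspace (comp_grading T) (d i + th p).
    by rewrite -[_ *: _]addr0; apply: (subspaceP sg) => //; case: sg.
  (* the value of [D_k] on [x i] has degree [d i + theta_k] *)
  rewrite -[RHS](grading_reweight (fun h => eps (h - d i) (X i))
    (comp_grading T) vP (s1 (x i))).
  by apply: eq_bigr => p _; rewrite scalerA mulrC addrAC subrr add0r.
exact: linear_zero (br_subst_linear x i).
Qed.

Lemma associated_unique (D D' E' : T -> T) (b : T) :
  associated eps D D' -> associated eps D E' -> derived T b -> D' b = E' b.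
Proof.
move=> hD hE Tb; apply/eqP; rewrite -subr_eq0; apply/eqP.
apply: (associated0 (E := D' - E')) Tb.
rewrite /associated.
have -> : ((0 : T -> T), D' - E') = (-1) *: (D, E') + (D, D').
  by congr pair; rewrite scaleN1r ?addNr // addrC.
exact: (subspaceP (subspace_span _)).
Qed.

Lemma phi_associated (U : set T) (D D' : T -> T) :
  graded_subspace (hcomp T) U -> direct_sum U (derived T) ->
  associated eps D D' -> phi eps U D = phi_with U D D'.
Proof.
move=> hU hUT hD; apply/funext => x; congr pair.
apply: (@associated_unique D) => //; last exact: derived_part_in.
exact: (xgetI 0 (P := [set E' | associated eps D E']) hD).
Qed.

End Associated.

(** * Derivations of [breve T] *)

Section BreveDerivation.
Variables (F : fieldType) (G : zmodType) (eps : G -> G -> F) (n : nat).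
Variable T : color_algebra F G n.
Hypothesis n_ge2 : (2 <= n)%N.

(** Of the [2 ^ n] terms only the one with all exponents equal to 1 survives:
one exponent [n] makes the total at least [n + (n - 1) > n]. *)
Lemma breve_brE (x : {ffun 'I_n -> breve T}) :
  br x = (0, br [ffun j => (x j : (T * T)%type).1]) :> breve T.
Proof.
change (breve_br x = (0, br [ffun j => (x j : (T * T)%type).1])).
have n1 : (n == 1)%N = false by case: n n_ge2 => [|[]].
rewrite /breve_br (bigD1 [ffun=> false]) //= [X in _ + X]big1 ?addr0 => [|s sP].
  rewrite (eq_bigr (fun=> 1%N)) => [|j _]; last by rewrite ffunE.
  rewrite sum1_card card_ord /breve_mono n1 eqxx; congr (_, br _).
  by apply/ffunP => j; rewrite !ffunE.
have [i si] : exists i, s i.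
  apply/existsP; apply: contraNT sP => /existsPn sN.
  by apply/eqP/ffunP => j; rewrite ffunE; apply: negbTE.
have lt_n : (n < \sum_(j < n) breve_expo n (s j))%N.
  rewrite (bigD1 i) //= {1}/breve_expo si -[X in (X < _)%N]addn0 ltn_add2l.
  (* any second index already contributes a positive exponent *)
  have [j ji] : exists j : 'I_n, j != i.
    have : (0 < #|[pred j | j != i]|)%N.
      by rewrite cardC1 card_ord; case: n n_ge2 => [|[]].
    by case/card_gt0P => j; exists j.
  rewrite (bigD1 j) //= addn_gt0 /breve_expo; case: (s j) => //.
  by rewrite (leq_trans _ n_ge2).
by rewrite /breve_mono !gtn_eqF // (leq_trans _ lt_n) // ltnW.
Qed.

Variable U : set T.
Hypotheses (hU : graded_subspace (hcomp T) U) (hUT : direct_sum U (derived T)).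

Lemma phi_with_homogeneous (theta : G) (D D' : T -> T) :
  homogeneous_map theta D -> homogeneous_map theta D' ->
  homogeneous_map theta (phi_with U D D').
Proof.
move=> [Dl Dh] [D'l D'h]; split=> [a u v|g x [x1 x2]].
- by congr pair; rewrite /= ?Dl // derived_part_linear // D'l.
- by split; [apply: Dh | apply: D'h; apply: derived_part_homogeneous].
Qed.

Lemma phi_with_der (D D' : T -> T) :
  homogeneous_qder_with eps D D' -> homogeneous_der eps (phi_with U D D').
Proof.
move=> [theta [hD hD' DD']]; exists theta; first exact: phi_with_homogeneous.
move=> d x xd; rewrite breve_brE.
set y := [ffun j => (x j : (T * T)%type).1].
have yd i : hcomp T (d i) (y i) by rewrite ffunE; have [] := xd i.
have -> : phi_with U D D' (0, br y) = (0, D' (br y)).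
  rewrite /phi_with /= (linear_zero hD.1).
  by rewrite (derived_part_id hU hUT (br_derived _)).
rewrite -(DD' d y yd).
have brD i : br (subst_at x i (phi_with U D D' (x i))) =
    (0, br (subst_at y i (D (y i)))) :> breve T.
  rewrite breve_brE; congr (0, br _).
  by apply/ffunP => j; rewrite !ffunE; case: eqP.
rewrite (eq_bigr _ (fun i _ => congr1 _ (brD i))).
rewrite [LHS]surjective_pairing; congr pair.
- by rewrite breve_sum1 big1 // => i _; apply: scaler0.
- by rewrite breve_sum2.
Qed.

Lemma phi_with_in_Der (D D' : T -> T) :
  associated eps D D' -> Der eps (breve T) (phi_with U D D').
Proof.
move=> h.
have sDer := subspace_span [set E | @homogeneous_der F G eps n (breve T) E].
apply: (span_le (B := [set p : (T -> T) * (T -> T) |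
  Der eps (breve T) (phi_with U p.1 p.2)]) _ _ h);
  last by move=> p /phi_with_der hp; apply: sub_span.
split=> [|a p q hp hq] /=; first exact: subspace0 sDer.
exact: (subspaceP sDer a hp hq).
Qed.

End BreveDerivation.

Theorem proposition3p4 (F : fieldType) (G : zmodType) (eps : G -> G -> F)
    (heps : bicharacter eps) (n : nat) (hn : (2 <= n)%N)
    (I : Type) (Omega : I -> multilinear_poly F n)
    (T : color_algebra F G n) (hT : omega_algebra eps T Omega)
    (U : set T) (hU : graded_subspace (hcomp T) U)
    (hUT : direct_sum U (derived T)) :
  ({in QDer eps T &, injective (phi eps U)} /\
   (forall D D' : T -> T, associated eps D D' -> phi eps U D = phi_with U D D')) /\
  phi eps U @` QDer eps T `<=` Der eps (breve T).
Proof.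
split; first split.
- (* the t-part of phi(D) on a t is D(a) *)
  move=> D E _ _ e; apply/funext => a.
  by have := congr1 (fun f => (f (a, 0) : (T * T)%type).1) e.
- by move=> D D'; apply: phi_associated.
- move=> _ [D /QDerP [D' hD] <-].
  by rewrite (phi_associated hU hUT hD); apply: phi_with_in_Der.
Qed.
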